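(* Let $\mathcal{A}$ be a finite set, let $(f_w)_{w\in\mathcal{A}}$ be similitudes $f_w:[0,1]\to[0,1]$, $f_w(x)=r_wx+b_w$, with $r_w\in(0,1)$ and $b_w\in[0,1]$, and let $F\subset[0,1]$ be the self-similar set associated with them, i.e. the non-empty compact set with $F=\bigcup_{w\in\mathcal{A}}f_w(F)$. Suppose there exist $j,k\in\mathcal{A}$ and a real number $l\geq 2$ such that $\log r_j/\log r_k$ is non-Liouville of degree $l$. Then, for any self-similar probability measure $\mu$ on $F$ (associated with the similitudes $(f_w)_{w\in\mathcal{A}}$) and any upper regularity exponent $\alpha\in[0,1]$ of $\mu$, as $\xi\to\pm\infty$, $$\widehat{\mu}(\xi)=O\left((\log|\xi|)^{-\alpha/(2(1+2\alpha)(8l-7))}\right).$$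
   Context: $\mathbb{N}=\{1,2,3,\ldots\}$. Self-similar measure: a Borel probability measure $\mu$ is self-similar, associated with the similitudes $(f_w)_{w\in\mathcal{A}}$, if $\mu=\sum_{w\in\mathcal{A}}p_w\,\mu\circ f_w^{-1}$ for some weights $(p_w)_{w\in\mathcal{A}}$ with $p_w>0$ for all $w\in\mathcal A$ and $\sum_{w\in\mathcal{A}}p_w=1$. Fourier transform: for a probability measure $\mu$ on $F\subset[0,1]$ and $\xi\in\mathbb{R}$, $\widehat{\mu}(\xi)=\int_F e^{-2\pi i\xi x}\,\mu(\mathrm{d}x)$. Non-Liouville: for $l>0$, a real number $\theta$ is non-Liouville of degree $l$ if there exists $c>0$ such that $|\theta-p/q|\geq c/q^l$ for all $p\in\mathbb{Z}$ and $q\in\mathbb{N}$. Upper regularity exponent: $\alpha\in[0,1]$ is an upper regularity exponent of a probability measure $\mu$ on a subset of $[0,1]$ if there exist $C_\alpha>0$ and $r_\alpha>0$ such that $\mu(I)\leq C_\alpha(\operatorname{diam} I)^\alpha$ for every interval $I\subset[0,1]$ with $\operatorname{diam} I<r_\alpha$ (with $0^0=1$). *)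

(* Defs.v *)
From mathcomp Require Import all_boot all_order all_algebra.
From mathcomp Require Import complex.
From mathcomp Require Import all_classical all_reals all_analysis.

Set Implicit Arguments.
Unset Strict Implicit.
Unset Printing Implicit Defensive.

Import Order.TTheory GRing.Theory Num.Theory.
Import numFieldNormedType.Exports.

Local Open Scope classical_set_scope.
Local Open Scope ring_scope.

(* The map is written on all of R; "f maps [0,1] to itself" is stated
   separately where it is assumed. *)
Definition similitude (R : realType) (r b x : R) : R := r * x + b.

(* When the maps are contractions, the conditions determine F uniquely
   (Hutchinson), so F may be quantified over as any set satisfying them. *)
Definition self_similar_set (R : realType) (A : finType) (f : A -> R -> R)
    (F : set R) : Prop :=
  [/\ F !=set0, compact F & F = \bigcup_(w in [set: A]) (f w @` F)].

Definition self_similar_measure (R : realType) (A : finType) (f : A -> R -> R)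
    (mu : probability (measurableTypeR R) R) : Prop :=
  exists p : A -> R,
    [/\ forall w, 0 < p w,
        \sum_(w : A) p w = 1 &
        forall B : set (measurableTypeR R), measurable B ->
          mu B = (\sum_(w : A) (p w)%:E * mu (f w @^-1` B))%E].

(* A probability measure on F, for F a Borel subset of R, is represented by
   the probability measure on R that gives F mass one. *)
Definition probability_on (R : realType) (F : set R)
    (mu : probability (measurableTypeR R) R) : Prop :=
  mu F = 1%E.

Definition complex_integral (R : realType)
    (mu : probability (measurableTypeR R) R) (D : set R) (f : R -> R[i]) : R[i] :=
  Complex (Rintegral mu D (fun x => complex.Re (f x)))
          (Rintegral mu D (fun x => complex.Im (f x))).

Definition expi (R : realType) (t : R) : R[i] := Complex (cos t) (sin t).

Definition fourier (R : realType) (F : set R)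
    (mu : probability (measurableTypeR R) R) (xi : R) : R[i] :=
  complex_integral mu F (fun x => expi (- (2 * pi * xi * x))).

Definition non_liouville (R : realType) (l theta : R) : Prop :=
  exists2 c : R, 0 < c &
    forall (p : int) (q : nat), (0 < q)%N ->
      c / (q%:R `^ l) <= `|theta - p%:~R / q%:R|.

Definition diam (R : realType) (I : set R) : R :=
  sup [set `|x - y| | x in I & y in I].

(* The convention 0^0 = 1 is the one of powR; diam of the empty set is
   sup set0 = 0. *)
Definition upper_regularity_exponent (R : realType)
    (mu : probability (measurableTypeR R) R) (alpha : R) : Prop :=
  0 <= alpha <= 1 /\
  exists C rho : R,
    [/\ 0 < C, 0 < rho &
        forall I : set R, is_interval I -> I `<=` `[0, 1] -> diam I < rho ->
          (mu I <= (C * diam I `^ alpha)%:E)%E].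

(* The =O_ notation looks up its filter among canonical filter_on structures,
   and the library declares none for the filters at infinity. *)
Canonical pinfty_filter_on (R : realType) :=
  FilterType (pinfty_nbhs R) (@filter_filter R _ (@proper_pinfty_nbhs R)).
Canonical ninfty_filter_on (R : realType) :=
  FilterType (ninfty_nbhs R) (@filter_filter R _ (@proper_ninfty_nbhs R)).

(* Main.v *)
(** Write E(x) = |mu^(e^x)|^2 and a_w = - ln r_w.  Self-similarity and Jensen's
    inequality give E(x) <= sum_w p_w E(x - a_w).  Fix a low level L = ln s and
    let h be the majorant of E that is harmonic for this walk above L.  Its
    increments h(x - a_j) - h(x) are again harmonic, and a martingale energy
    count bounds them by O(1 / sqrt n) as soon as the walk needs n steps to come
    down from x to L.  Hence h(x) is close to the average of h over the points
    x - (n a_j - floor(n p / q) a_k), n < q, where p / q is a Dirichlet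
    approximation of a_j / a_k: these points are a perturbed arithmetic
    progression of step a_k / q.  When they are followed down to L, the
    averages of E that appear are integrals against mu x mu of
    q^-1 sum_m cos (2 pi s e^(- a_k m / q) (x - y)), which are small unless
    |x - y| < rho, and the mass of that strip is O(rho^alpha).  The
    non-Liouville condition bounds q from below in terms of the quality of the
    approximation, and optimizing s, rho and q gives a power of ln |xi|. *)

Require Import Defs.
From mathcomp Require Import all_boot all_order all_algebra.
From mathcomp Require Import complex.
From mathcomp Require Import all_classical all_reals all_analysis.
From mathcomp Require Import measurable_realfun ring lra.

Import Order.TTheory GRing.Theory Num.Theory.
Import numFieldNormedType.Exports.
Local Open Scope classical_set_scope.
Local Open Scope ring_scope.

(** * Rational approximation *)

(** Pigeonhole: the fractional parts of [n t] for [n = 0, ..., Q] fall into [Q] bins. Cancelling the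
    gcd only shrinks the error, and coprimality makes [n p mod q] run through all residues. *)
Lemma dirichlet_coprime (R : realType) (t : R) (Q : nat) :
  0 <= t -> (0 < Q)%N ->
  exists p q : nat,
    [/\ (0 < q <= Q)%N, coprime p q & `|q%:R * t - p%:R| <= Q%:R^-1].
Proof.
move=> t0 Q0; have QR : 0 < Q%:R :> R by rewrite ltr0n.
pose fl (n : nat) := Num.truncn (n%:R * t).
have flP n : (fl n)%:R <= n%:R * t < (fl n)%:R + 1.
  by rewrite natr1; apply: truncn_itv; rewrite mulr_ge0.
pose fr (n : nat) := n%:R * t - (fl n)%:R.
have fr01 n : 0 <= fr n < 1.
  by rewrite /fr; have := flP n => /andP[? ?]; apply/andP; split; lra.
pose bin (n : nat) := Num.truncn (Q%:R * fr n).
have binP n : (bin n)%:R <= Q%:R * fr n < (bin n)%:R + 1.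
  rewrite natr1; apply: truncn_itv; rewrite mulr_ge0//.
  by case/andP: (fr01 n).
have binQ n : (bin n < Q)%N.
  rewrite -(ltr_nat R); have /andP[+ _] := binP n; move=> /le_lt_trans; apply.
  by rewrite -[ltRHS]mulr1 ltr_pM2l//; case/andP: (fr01 n).
have /injectivePn [i [i' ii' eqb]] :
    ~~ injectiveb (fun i : 'I_Q.+1 => Ordinal (binQ i)).
  apply/negP => /injectiveP /leq_card; by rewrite !card_ord ltnn.
have {}eqb : bin i = bin i' by case: eqb.
wlog lt_ii' : i i' ii' eqb / (i < i')%N => [wl|].
  have [|le] := ltnP i i'; first exact: wl.
  by apply: (wl i' i); rewrite 1?eq_sym// ltn_neqAle le andbT eq_sym.
have le_fl : (fl i <= fl i')%N.
  by apply: le_truncn; rewrite ler_wpM2r// ler_nat ltnW.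
pose q := (i' - i)%N; pose p := (fl i' - fl i)%N; pose d := gcdn p q.
have q0 : (0 < q)%N by rewrite subn_gt0.
have d0 : (0 < d)%N by rewrite gcdn_gt0 q0 orbT.
have dq : (q %/ d * d)%N = q by rewrite divnK// dvdn_gcdr.
have dp : (p %/ d * d)%N = p by rewrite divnK// dvdn_gcdl.
exists (p %/ d)%N, (q %/ d)%N; split.
- rewrite divn_gt0// dvdn_leq ?dvdn_gcdr//= (leq_trans (leq_div _ _))//.
  by rewrite leq_subLR (leq_trans _ (leq_addl _ _))// -ltnS.
- rewrite /coprime -(eqn_pmul2r d0) mul1n muln_gcdl dp dq; exact: eqxx.
- have dR : 1 <= d%:R :> R by rewrite ler1n.
  apply: (@le_trans _ _ (d%:R * `|(q %/ d)%:R * t - (p %/ d)%:R|)).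
    by rewrite ler_peMl.
  rewrite -{1}(ger0_norm (ler0n R d)) -normrM mulrBr mulrA -!natrM !(mulnC d) dp dq.
  rewrite /q /p !natrB// ?(ltnW lt_ii')//.
  rewrite -(ler_pM2l QR) divff ?gt_eqF// -{1}(ger0_norm (ltW QR)) -normrM.
  have := binP i; have := binP i'; rewrite eqb /fr => /andP[? ?] /andP[? ?].
  by rewrite ler_norml; apply/andP; split; lra.
Qed.

(** Multiplication by a unit permutes the residues. It puts the points indexed by [n p mod q] back
    in increasing order, where sums telescope. *)
Lemma sum_mod_coprime (V : nmodType) (p q : nat) (f : nat -> V) :
  coprime p q -> \sum_(n < q) f (n * p %% q)%N = \sum_(n < q) f n.
Proof.
move=> cpq; case: q cpq => [|q] cpq; first by rewrite !big_ord0.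
pose s (n : 'I_q.+1) : 'I_q.+1 := inord (n * p %% q.+1).
have sE n : s n = (n * p %% q.+1)%N :> nat by rewrite inordK// ltn_pmod.
have s_inj : injective s.
  move=> n n' /(congr1 val) /=; rewrite !sE => /eqP.
  wlog le : n n' / (n' <= n)%N => [wl|].
    by have [/wl//|/ltnW /wl le] := leqP n' n; rewrite eq_sym => /le/esym.
  rewrite eqn_mod_dvd ?leq_mul2r ?le ?orbT// -mulnBl Gauss_dvdl 1?coprime_sym//.
  case: (posnP (n - n')) => [/eqP|nn' /(dvdn_leq nn')].
    by rewrite subn_eq0 => le' _; apply/val_inj/eqP; rewrite eqn_leq le' le.
  by rewrite leqNgt (leq_ltn_trans (leq_subr _ _) (ltn_ord n)).
rewrite [RHS](reindex_inj s_inj)/=; apply: eq_bigr => n _.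
by rewrite sE.
Qed.

(** The squeeze [c / q^l <= |t - p / q| <= 1 / (q Q)] forbids a denominator much smaller than the
    [(l - 1)]-th root of [Q]. *)
Lemma convergent_denominator_ge (R : realType) (l t : R) :
  non_liouville l t ->
  exists2 c : R, 0 < c & forall p q Q : nat, (0 < q)%N -> (0 < Q)%N ->
    `|q%:R * t - p%:R| <= Q%:R^-1 -> c * Q%:R <= q%:R `^ (l - 1).
Proof.
move=> [c c0 ct]; exists c => // p q Q q0 Q0 pq.
have q0' : 0 < q%:R :> R by rewrite ltr0n.
have Q0' : 0 < Q%:R :> R by rewrite ltr0n.
have ql0 : 0 < q%:R `^ l by exact: powR_gt0.
have := ct p%:Z q q0; rewrite -[p%:Z%:~R]/(p%:R) => cq.
have -> : q%:R `^ (l - 1) = q%:R `^ l / q%:R.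
  by rewrite powRB ?powRr1// (gt_eqF q0') implybT.
have iQ0 : 0 < Q%:R^-1 :> R by rewrite invr_gt0.
rewrite -(ler_pM2r iQ0) mulfK ?gt_eqF//.
have -> : q%:R `^ l / q%:R / Q%:R = q%:R `^ l * (Q%:R^-1 / q%:R).
  by rewrite -mulrA (mulrC q%:R^-1).
rewrite -ler_pdivrMl// mulrC (le_trans cq)//.
rewrite ler_pdivlMr//.
rewrite -{2}(gtr0_norm q0') -normrM mulrBl divfK ?gt_eqF// mulrC.
exact: pq.
Qed.

(** * Cosine sums along an exponential *)

Lemma mean_value (R : realType) (f df : R -> R) (x y : R) :
  (forall z : R, is_derive z 1 f (df z)) -> x <= y ->
  exists2 c, x <= c <= y & f y - f x = df c * (y - x).
Proof.
move=> fdf xy.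
have cf : {within `[x, y], continuous f}.
  by apply: derivable_within_continuous => z _; case: (fdf z).
have [c cxy ?] := MVT_segment xy (fun z _ => fdf z) cf.
by exists c => //; rewrite in_itv in cxy.
Qed.

Lemma lipschitz_on (R : realType) (f df : R -> R) (K B x y : R) :
  (forall z : R, is_derive z 1 f (df z)) -> (forall z, z <= B -> `|df z| <= K) ->
  x <= B -> y <= B -> `|f x - f y| <= K * `|x - y|.
Proof.
move=> fdf dfK; wlog xy : x y / x <= y => [wl|] xB yB.
  have [xy|/ltW yx] := leP x y; first exact: wl.
  by rewrite distrC (distrC x); exact: wl.
rewrite distrC (distrC x); have [c /andP[_ cy] ->] := mean_value R f df x y fdf xy.
by rewrite normrM ler_wpM2r// dfK// (le_trans cy).
Qed.

Lemma cos_lipschitz (R : realType) (x y : R) : `|cos x - cos y| <= `|x - y|.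
Proof.
rewrite -[leRHS]mul1r; apply: (@lipschitz_on R cos (fun z => - sin z) 1 (Num.max x y)).
- by move=> z _; rewrite normrN sin_max.
- by rewrite le_max lexx.
- by rewrite le_max lexx orbT.
Qed.

Lemma expR_lipschitz (R : realType) (B x y : R) :
  x <= B -> y <= B -> `|expR x - expR y| <= expR B * `|x - y|.
Proof.
apply: (@lipschitz_on R expR expR) => z zB.
by rewrite ger0_norm ?expR_ge0// ler_expR.
Qed.

(** Up to reordering, this is a Riemann sum for [q] times the integral of [cos (l e^(- b v))] over
    [0, 1], which integration by parts bounds by O(q / l). The term [2 l b] is the discretization
    error. *)
Lemma cos_expR_sum_le (R : realType) (b l : R) (p q : nat) (y : 'I_q -> R) :
  0 < b -> 0 < l -> (0 < q)%N -> coprime p q ->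
  (forall n : 'I_q, `|y n - b * (n * p %% q)%N%:R / q%:R| <= b / q%:R) ->
  `|\sum_(n < q) cos (l * expR (- y n))| <=
  expR b * (2 * (l * b) + (2 / b + 1) / l * q%:R).
Proof.
move=> b0 l0 q0 cpq yb; have lb0 : 0 < l * b by exact: mulr_gt0.
have q0' : 0 < q%:R :> R by rewrite ltr0n.
(* [F] is a primitive of [cos (l * expR (- (b * v)))] up to a term of order [1 / l] *)
pose F v : R := - (l * b)^-1 * (expR (b * v) * sin (l * expR (- (b * v)))).
pose dF v : R := cos (l * expR (- (b * v))) - expR (b * v) * sin (l * expR (- (b * v))) / l.
have FdF (v : R) : is_derive v 1 F (dF v).
  rewrite /F; apply: is_derive_eq.
  rewrite /dF /GRing.scale/= !mulr1.
  have : expR (b * v) * expR (- (b * v)) = 1 by rewrite -expRD subrr expR0.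
  set E := expR (b * v); set E' := expR (- _) => EE.
  by rewrite -[X in _ = X - _]mulr1 -EE; field; rewrite !gt_eqF.
(* On the cell from [m / q] to [(m + 1) / q] the mean value theorem turns the increment of [F] into
   [dF c]. As [y n] and [b c] differ by at most [2 b / q], the cosines are close; the sine term of
   [dF] is at most [expR b / l]. *)
have key (n : 'I_q) : let m := (n * p %% q)%N in
  `|cos (l * expR (- y n)) - q%:R * (F (m.+1%:R / q%:R) - F (m%:R / q%:R))| <=
  2 * (l * b) * expR b / q%:R + expR b / l.
  move=> m; have mq : (m.+1 <= q)%N by rewrite ltn_mod.
  have iq0 : 0 < q%:R^-1 :> R by rewrite invr_gt0.
  have mqR : m.+1%:R / q%:R <= 1 :> R by rewrite ler_pdivrMr// mul1r ler_nat.
  have m0 : 0 <= m%:R / q%:R :> R by rewrite divr_ge0.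
  have m1E : m.+1%:R / q%:R = m%:R / q%:R + q%:R^-1 :> R by rewrite -natr1 mulrDl mul1r.
  have [|c /andP[c1 c2] ->] := mean_value _ F dF (m%:R / q%:R) (m.+1%:R / q%:R) FdF.
    by rewrite m1E lerDl ltW.
  rewrite m1E addrAC subrr add0r (_ : q%:R * _ = dF c); last by field; rewrite gt_eqF.
  rewrite m1E in c2 mqR.
  have c1' : 0 <= b * c by rewrite mulr_ge0 ?(ltW b0)//; lra.
  rewrite /dF opprB addrCA (le_trans (ler_normD _ _))// [leLHS]addrC lerD//.
    apply: le_trans (cos_lipschitz _ _ _) _.
    rewrite -mulrBr normrM (gtr0_norm l0).
    rewrite (_ : 2 * _ * _ / _ = l * (expR b * (2 * (b * q%:R^-1)))); last first.
      by field; rewrite gt_eqF.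
    rewrite ler_wpM2l ?(ltW l0)//.
    have := yb n; rewrite -/m ler_norml => /andP[y1 y2].
    have bc : b * c <= b * (m%:R / q%:R + q%:R^-1) by rewrite ler_pM2l.
    have bc' : b * (m%:R / q%:R) <= b * c by rewrite ler_pM2l.
    have bq : b * q%:R^-1 <= b by rewrite -[leRHS]mulr1 ler_pM2l// invf_le1// ler1n.
    have bm : 0 <= b * (m%:R / q%:R) by rewrite mulr_ge0// ltW.
    rewrite mulrDr in bc; rewrite -mulrA in y1 y2.
    (* [y n] may be negative, but never below [- b / q], so both exponents are at most [b]. *)
    apply: le_trans (expR_lipschitz _ b _ _ _ _) _; [lra|lra|].
    rewrite ler_wpM2l ?expR_ge0//.
    rewrite ler_norml; apply/andP; split; lra.
  rewrite normrM normfV (gtr0_norm l0) ler_pM2r ?invr_gt0//.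
  rewrite normrM (ger0_norm (expR_ge0 _)) -[leRHS]mulr1 ler_pM ?expR_ge0 ?normr_ge0//.
    by rewrite ler_expR -[leRHS]mulr1 ler_pM2l//; lra.
  exact: sin_max.
have tele : \sum_(n < q) q%:R * (F ((n * p %% q).+1%:R / q%:R) - F ((n * p %% q)%:R / q%:R))
    = q%:R * (F 1 - F 0).
  pose f m := q%:R * (F (m.+1%:R / q%:R) - F (m%:R / q%:R)).
  rewrite (sum_mod_coprime _ p q f cpq) /f -mulr_sumr; congr (_ * _).
  rewrite -(big_mkord xpredT (fun m => F (m.+1%:R / q%:R) - F (m%:R / q%:R))).
  by rewrite telescope_sumr// mul0r divff ?gt_eqF.
have Fle v : v <= 1 -> `|F v| <= expR b / (l * b).
  move=> v1; rewrite /F normrM normrN normfV (gtr0_norm lb0) mulrC.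
  rewrite ler_pM2r ?invr_gt0//.
  rewrite normrM (ger0_norm (expR_ge0 _)) -[leRHS]mulr1 ler_pM ?expR_ge0 ?normr_ge0//.
    by rewrite ler_expR -[leRHS]mulr1 ler_pM2l.
  exact: sin_max.
have F10 : `|q%:R * (F 1 - F 0)| <= q%:R * (2 * (expR b / (l * b))).
  rewrite normrM (gtr0_norm q0') ler_pM2l// (le_trans (ler_normB _ _))//.
  by have := Fle 1 (lexx _); have := Fle 0 ler01; lra.
have dev : `|\sum_(n < q) cos (l * expR (- y n)) - q%:R * (F 1 - F 0)| <=
    q%:R * (2 * (l * b) * expR b / q%:R + expR b / l).
  rewrite -tele -sumrB; apply: (le_trans (ler_norm_sum _ _ _)).
  set K := _ + expR b / l; have -> : q%:R * K = \sum_(n < q) K.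
    by rewrite sumr_const card_ord mulr_natl.
  by apply: ler_sum => n _; exact: key.
rewrite -[X in `|X|](subrK (q%:R * (F 1 - F 0))).
rewrite (le_trans (ler_normD _ _))// (le_trans (lerD dev F10))// le_eqVlt.
by apply/orP; left; apply/eqP; field; rewrite !gt_eqF.
Qed.

(** * Harmonic functions of a random walk on the line *)

Lemma variance_identity (R : realType) (A : finType) (p f : A -> R) :
  \sum_w p w = 1 ->
  \sum_w p w * f w ^+ 2 =
  (\sum_w p w * f w) ^+ 2 + \sum_w p w * (f w - \sum_v p v * f v) ^+ 2.
Proof.
move=> p1; set m := \sum_v p v * f v.
under [in RHS]eq_bigr => w _.
  rewrite (_ : p w * (f w - m) ^+ 2 =
    p w * f w ^+ 2 + (- (2 * m)) * (p w * f w) + m ^+ 2 * p w); last by ring.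
  over.
rewrite !big_split /= -!mulr_sumr p1 -/m; ring.
Qed.

Lemma sqr_avg_le (R : realType) (A : finType) (p f : A -> R) :
  (forall w, 0 <= p w) -> \sum_w p w = 1 ->
  (\sum_w p w * f w) ^+ 2 <= \sum_w p w * f w ^+ 2.
Proof.
move=> p0 p1; rewrite (variance_identity _ _ p f)// lerDl sumr_ge0// => w _.
by rewrite mulr_ge0// sqr_ge0.
Qed.

(* Increments of a harmonic function are harmonic, so their squares and
   [h ^+ 2] are subharmonic; this makes the bound for [n] average to that for
   [n.+1], the extra increment being paid for by the variance of [h]. *)
Lemma harmonic_gradient (R : realType) (A : finType) (p a : A -> R)
    (h : R -> R) (L U M : R) (j : A) (n : nat) :
  (forall w, 0 <= p w) -> \sum_w p w = 1 -> (forall w, 0 < a w <= M) ->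
  (forall x, 0 <= h x <= 1) ->
  (forall x : R, L <= x < U -> h x = \sum_w p w * h (x - a w)) ->
  forall x : R, L + n.+1%:R * M <= x < U ->
  n%:R * p j * (h (x - a j) - h x) ^+ 2 + h x ^+ 2 <= 1.
Proof.
move=> p0 p1 aM h01 harm.
elim: n => [|n IH] x /andP[Lx xU].
  by rewrite !mul0r add0r expr_le1//; case/andP: (h01 x).
have [aj0 ajM] := andP (aM j).
have M0 : 0 <= M by apply: le_trans ajM; exact: ltW.
have nM : 0 <= n%:R * M by rewrite mulr_ge0.
move: Lx; rewrite -natr1 -(natr1 n) => Lx.
set D := fun y => h (y - a j) - h y.
have hx : h x = \sum_w p w * h (x - a w) by apply: harm; rewrite xU andbT; lra.
have Dx : D x = \sum_w p w * D (x - a w).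
  rewrite /D hx (harm (x - a j)) -?sumrB; last by apply/andP; split; lra.
  by apply: eq_bigr => w _; rewrite mulrBr addrAC.
have D2 : D x ^+ 2 <= \sum_w p w * D (x - a w) ^+ 2 by rewrite Dx; exact: sqr_avg_le.
(* The mean of [h (x - a w)] is [h x], so the [j]-th term of the variance is [p j * D x ^+ 2]; the
   others are dropped. *)
have h2 : h x ^+ 2 + p j * D x ^+ 2 <= \sum_w p w * h (x - a w) ^+ 2.
  rewrite variance_identity// -hx lerD2l (bigD1 j)//= lerDl sumr_ge0// => w _.
  by rewrite mulr_ge0// sqr_ge0.
have Dh : \sum_w p w * (n%:R * p j * D (x - a w) ^+ 2 + h (x - a w) ^+ 2) <= 1.
  rewrite -[leRHS]p1; apply: ler_sum => w _; rewrite -[leRHS]mulr1 ler_wpM2l//.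
  apply: IH; have /andP[aw0 awM] := aM w; rewrite -natr1; apply/andP; split; lra.
move: Dh; under eq_bigr do rewrite mulrDr mulrCA.
rewrite big_split/= -mulr_sumr -/(D x) => Dh.
have npD : n%:R * p j * D x ^+ 2 <= n%:R * p j * \sum_w p w * D (x - a w) ^+ 2.
  by rewrite ler_wpM2l// mulr_ge0.
by rewrite mulrDl mul1r mulrDl; lra.
Qed.

(** The expected value of [g] at the first point below [L] of the walk that starts at [x] and jumps
    by [- a w] with probability [p w]. The fuel [n] bounds the number of jumps; paths not below [L]
    by then contribute 0. *)
Fixpoint harmonic_ext (R : realType) (A : finType) (p a : A -> R) (L : R)
    (g : R -> R) (n : nat) (x : R) : R :=
  if x < L then g x
  else if n is n'.+1 then \sum_w p w * harmonic_ext R A p a L g n' (x - a w)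
  else 0.

Arguments harmonic_ext {R A} p a L g n x.

Lemma harmonic_ext_bounds (R : realType) (A : finType) (p a : A -> R) (L : R)
    (g : R -> R) (n : nat) (x : R) :
  (forall w, 0 <= p w) -> \sum_w p w = 1 -> (forall y : R, 0 <= g y <= 1) ->
  0 <= harmonic_ext p a L g n x <= 1.
Proof.
move=> p0 p1 g01; elim: n x => [|n IH] x /=; case: ifP => // _.
  by rewrite lexx ler01.
rewrite sumr_ge0/= => [|w _]; last by rewrite mulr_ge0//; case/andP: (IH (x - a w)).
rewrite -p1; apply: ler_sum => w _; rewrite -[leRHS]mulr1 ler_wpM2l//.
by case/andP: (IH (x - a w)).
Qed.

(** Every jump goes down by at least [m], so from such an [x] all paths are below [L] before the
    fuel runs out. *)
Lemma harmonic_ext_stable (R : realType) (A : finType) (p a : A -> R) (L m : R)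
    (g : R -> R) (n : nat) (x : R) :
  (forall w, m <= a w) -> x < L + n%:R * m ->
  harmonic_ext p a L g n.+1 x = harmonic_ext p a L g n x.
Proof.
move=> ma; elim: n x => [|n IH] x xL; first by rewrite mul0r addr0 in xL; rewrite /= xL.
rewrite /=; case: ifP => // _; apply: eq_bigr => w _; congr (_ * _).
by apply: IH; have := ma w; rewrite -natr1 in xL; lra.
Qed.

(** The recursion yields the average with one unit of fuel less; at the points [x - a w] stability
    makes that unit irrelevant. *)
Lemma harmonic_extE (R : realType) (A : finType) (p a : A -> R) (L m : R)
    (g : R -> R) (n : nat) (x : R) :
  (forall w, m <= a w) -> L <= x < L + n%:R * m ->
  harmonic_ext p a L g n x = \sum_w p w * harmonic_ext p a L g n (x - a w).
Proof.
move=> ma /andP[Lx xL].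
case: n xL => [|n] xL; first by rewrite mul0r addr0 ltNge Lx in xL.
rewrite [LHS]/= ltNge Lx/=; apply: eq_bigr => w _; congr (_ * _).
by apply/esym/(harmonic_ext_stable _ _ _ _ _ m) => //; have := ma w; rewrite -natr1 in xL; lra.
Qed.

(** Optional stopping for a submartingale: jumps have length at most [M], so the walk first lands in
    [L - M, L), where [g] agrees with [f]. *)
Lemma harmonic_ext_ge (R : realType) (A : finType) (p a : A -> R) (L m M : R)
    (f g : R -> R) (n : nat) (x : R) :
  (forall w, 0 <= p w) -> (forall w, m <= a w <= M) ->
  (forall y : R, f y <= \sum_w p w * f (y - a w)) ->
  (forall y : R, L - M <= y < L -> g y = f y) ->
  L - M <= x < L + n%:R * m -> f x <= harmonic_ext p a L g n x.
Proof.
move=> p0 maM fsub gf; elim: n x => [|n IH] x /andP[Lx xL].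
  by rewrite mul0r addr0 in xL; rewrite /= xL gf ?Lx// xL.
rewrite /=; case: (ltP x L) => xL'; first by rewrite gf ?Lx// xL'.
apply: le_trans (fsub x) _; apply: ler_sum => w _; rewrite ler_wpM2l//; apply: IH.
by have /andP[? ?] := maM w; rewrite -natr1 in xL; apply/andP; split; lra.
Qed.

(* [1 + (min x hi - lo) / m] dominates the expected number of visits to
   [lo, hi] of a walk from x whose steps to the left are at least m. *)
Lemma harmonic_ext_sum_le (R : realType) (A : finType) (p a : A -> R)
    (L m M Y B : R) (g : R -> R) (q n : nat) (y : 'I_q -> R) (x : R) :
  (forall w, 0 <= p w) -> \sum_w p w = 1 -> 0 < m -> (forall w, m <= a w <= M) ->
  0 <= M -> 0 <= Y -> 0 <= B -> (forall i, `|y i| <= Y) ->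
  (forall z : R, 0 <= g z) -> (forall z : R, z < L - M -> g z = 0) ->
  (forall z : R, L - M - Y <= z <= L + Y -> \sum_i g (z - y i) <= B) ->
  \sum_i harmonic_ext p a L g n (x - y i) <= B * (1 + (M + 2 * Y) / m).
Proof.
move=> p0 p1 m0 maM M0 Y0 B0 yY g0 gL0 gB.
set lo := L - M - Y; set hi := L + Y.
have lohi : lo <= hi by rewrite /lo /hi; lra.
pose b x := if x < lo then 0 else 1 + (Num.min x hi - lo) / m.
have b0 z : 0 <= b z.
  rewrite /b; case: ltP => // loz; rewrite addr_ge0// divr_ge0 ?(ltW m0)// subr_ge0.
  by rewrite le_min loz.
(* The boundary values alone: [g'] is what a path collects when it stops. All its translates by the
   [y i] vanish outside [lo, hi]. *)
pose g' z := if z < L then g z else 0.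
have g'0 z : 0 <= g' z by rewrite /g'; case: ifP.
have g'0z i z : ~~ (lo <= z <= hi) -> g' (z - y i) = 0.
  have := yY i; rewrite ler_norml => /andP[? ?] zlo; rewrite /g'; case: ltP => // ?.
  by apply: gL0; rewrite ltNge; apply: contra zlo => ?; apply/andP; split; rewrite /lo/hi; lra.
have gB' z : lo <= z <= hi -> \sum_i g' (z - y i) <= B.
  move=> zlo; apply: le_trans (gB _ zlo); apply: ler_sum => i _; rewrite /g'.
  by case: ifP.
(* [B * b] is a supersolution with source the sum of the [g' (z - y i)]. Inside [lo, hi] the source
   is at most [B] and each jump lowers [b] by at least 1; outside, the source is zero and [b] does
   not increase along jumps. *)
have bsup z : \sum_i g' (z - y i) + B * (\sum_w p w * b (z - a w)) <= B * b z.
  have [zlo|zlo] := ltP z lo.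
    rewrite big1 => [|i _]; last by rewrite g'0z// negb_and -ltNge zlo.
    rewrite add0r ler_wpM2l// big1 // => w _.
    by rewrite /b ifT ?mulr0//; have /andP[? ?] := maM w; lra.
  have bz : b z = 1 + (Num.min z hi - lo) / m by rewrite /b ltNge zlo.
  have [zhi|zhi] := leP z hi.
    have : \sum_w p w * b (z - a w) <= b z - 1.
      rewrite -[leRHS]mul1r -[X in X * _]p1 mulr_suml; apply: ler_sum => w _.
      rewrite ler_wpM2l// bz (min_idPl zhi) addrAC subrr add0r /b.
      have /andP[? ?] := maM w.
      case: ltP => ?; first by rewrite divr_ge0 ?(ltW m0)// subr_ge0.
      rewrite (min_idPl _); last by lra.
      by rewrite -[X in X + _](divff (lt0r_neq0 m0)) -mulrDl ler_pM2r ?invr_gt0//; lra.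
    move=> /(ler_wpM2l B0) bz1; have := gB' z; rewrite zlo zhi => /(_ isT); lra.
  rewrite big1 => [|i _]; last by rewrite g'0z// negb_and -!ltNge zhi orbT.
  rewrite add0r ler_wpM2l// -[leRHS]mul1r -[X in X * _]p1 mulr_suml; apply: ler_sum => w _.
  rewrite ler_wpM2l// bz (min_idPr (ltW zhi)) /b; case: ltP => ?.
    by rewrite addr_ge0// divr_ge0 ?(ltW m0)// subr_ge0.
  by rewrite lerD2l ler_pM2r ?invr_gt0// lerD2r ge_min lexx orbT.
have main k z : \sum_i harmonic_ext p a L g k (z - y i) <= B * b z.
  elim: k z => [|k IH] z.
    apply: le_trans (bsup z); apply: ler_wpDr.
      by rewrite mulr_ge0// sumr_ge0// => w _; rewrite mulr_ge0.
    by apply: ler_sum => i _; rewrite /g' /=.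
  apply: le_trans (bsup z).
  have -> : B * (\sum_w p w * b (z - a w)) = \sum_w p w * (B * b (z - a w)).
    by rewrite mulr_sumr; apply: eq_bigr => w _; rewrite mulrCA.
  apply: (@le_trans _ _ (\sum_i g' (z - y i) +
    \sum_w p w * \sum_i harmonic_ext p a L g k (z - a w - y i))); last first.
    by rewrite lerD2l; apply: ler_sum => w _; rewrite ler_wpM2l.
  under [X in _ + X]eq_bigr do rewrite mulr_sumr.
  (* Term by term: a path already below [L] stops and collects [g']; any other makes one more
     jump. *)
  rewrite exchange_big/= -big_split/=; apply: ler_sum => i _.
  have hge0 k' z' : 0 <= harmonic_ext p a L g k' z'.
    elim: k' z' => [|k' IH'] z' /=; case: ifP => // _.
    by rewrite sumr_ge0// => w _; rewrite mulr_ge0.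
  rewrite /g'; case: ifP => _.
    by rewrite lerDl sumr_ge0// => w _; rewrite mulr_ge0.
  by rewrite add0r; apply: ler_sum => w _; rewrite ler_wpM2l// addrAC.
apply: le_trans (main n x) _; rewrite ler_wpM2l// /b; case: ltP => ?.
  by rewrite addr_ge0// divr_ge0 ?(ltW m0)//; lra.
rewrite lerD2l ler_pM2r ?invr_gt0//.
have : Num.min x hi <= hi by rewrite ge_min lexx orbT.
by rewrite /lo /hi; lra.
Qed.

Lemma dist_iter_le (R : realType) (h : R -> R) (c e : R) (n : nat) (x : R) :
  (forall i, (i < n)%N -> `|h (x + i%:R * c + c) - h (x + i%:R * c)| <= e) ->
  `|h (x + n%:R * c) - h x| <= n%:R * e.
Proof.
elim: n => [|n IH] he; first by rewrite !mul0r addr0 subrr normr0.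
have {}IH := IH (fun i ni => he i (ltnW ni)).
rewrite -natr1 !mulrDl !mul1r (le_trans _ (lerD IH (he n (ltnSn n))))//.
rewrite (le_trans _ (ler_normD _ _))// le_eqVlt; apply/orP; left; apply/eqP.
by congr `|_|; rewrite addrA [RHS]addrC; ring.
Qed.

(* Moving the starting point by [a j] or [a k] hardly changes the value of the
   harmonic majorant, so the value at X is close to the average of its values
   over the points [X - y i]. *)
Lemma subharmonic_le_avg (R : realType) (A : finType) (p a : A -> R)
    (f : R -> R) (j k : A) (L X m M Y W B e : R) (N q : nat) (u v : 'I_q -> nat) :
  let y i := (u i)%:R * a j - (v i)%:R * a k in
  (0 < q)%N ->
  (forall w, 0 <= p w) -> \sum_w p w = 1 -> 0 < m -> (forall w, m <= a w <= M) ->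
  (forall x : R, 0 <= f x <= 1) ->
  (forall x : R, f x <= \sum_w p w * f (x - a w)) ->
  (forall i, `|y i| <= Y) -> (forall i, (u i + v i)%:R <= W) ->
  0 <= e -> 1 <= N%:R * p j * e ^+ 2 -> 1 <= N%:R * p k * e ^+ 2 ->
  (forall i, L + N.+1%:R * M + (u i)%:R * a j <= X) ->
  (forall z : R, L - M - Y <= z <= L + Y -> \sum_i f (z - y i) <= q%:R * B) ->
  f X <= B * (1 + (M + 2 * Y) / m) + W * e.
Proof.
move=> y q0 p0 p1 m0 maM f01 fsub yY uvW e0 Nj Nk uX fB.
have [am aM] : (forall w, m <= a w) /\ (forall w, a w <= M).
  by split => w; case/andP: (maM w).
have a0 w : 0 < a w by exact: lt_le_trans (am w).
have M0 : 0 <= M by apply: le_trans (aM j); exact: ltW.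
have Y0 : 0 <= Y by apply: le_trans (yY (Ordinal q0)).
have q0' : 0 < q%:R :> R by rewrite ltr0n.
(* Cutting [f] off where the walk from above [L] never lands leaves the majorant unaffected and
   confines the boundary data to a bounded strip. *)
pose g x := if x < L - M then 0 else f x.
have g01 x : 0 <= g x <= 1 by rewrite /g; case: ifP => // _; rewrite lexx ler01.
(* Enough fuel for [h] to be harmonic from [L] up to beyond every point used below. *)
pose n := (Num.truncn ((X + Y + M - L) / m)).+1.
have nX : X + Y + M < L + n%:R * m.
  rewrite -ltrBlDl -ltr_pdivrMr//; exact: truncnS_gt.
pose h := harmonic_ext p a L g n.
have h01 x : 0 <= h x <= 1 by exact: harmonic_ext_bounds.
have harm x : L <= x < L + n%:R * m -> h x = \sum_w p w * h (x - a w).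
  exact: harmonic_extE.
have aM' w : 0 < a w <= M by rewrite a0 aM.
(* The gradient bound gives [N p_w D^2 <= 1 <= N p_w e^2] for the increment [D]. *)
have grad w x : 1 <= N%:R * p w * e ^+ 2 ->
    L + N.+1%:R * M <= x < L + n%:R * m -> `|h (x - a w) - h x| <= e.
  move=> Ne xL.
  have := @harmonic_gradient R A p a h L _ M w N p0 p1 aM' h01 harm x xL.
  have := sqr_ge0 (h x); set D := h _ - h _ => hx hD.
  rewrite -ler_sqr ?nnegrE// real_normK ?num_real//.
  have Np : 0 < N%:R * p w.
    rewrite lt0r mulr_ge0// andbT; apply: contraTneq Ne => ->.
    by rewrite mul0r -ltNge ltr01.
  by rewrite -(ler_pM2l Np); lra.
have NM : 0 <= N.+1%:R * M by rewrite mulr_ge0.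
have uL i : L + N.+1%:R * M <= X - (u i)%:R * a j by have := uX i; lra.
have X0 : L + N.+1%:R * M <= X.
  by apply: le_trans (uX (Ordinal q0)); rewrite lerDl mulr_ge0// ltW.
(* The path from [X] to [X - y i] makes [u i] moves down by [a j], then [v i] moves up by [a k]. Its
   lowest point is the turning point, which is still [N.+1] maximal jumps above [L]. *)
have dist i : `|h (X - y i) - h X| <= W * e.
  have := yY i; rewrite ler_norml => /andP[yl yu].
  have h1 : `|h (X + (u i)%:R * - a j) - h X| <= (u i)%:R * e.
    apply: dist_iter_le => t tu; apply: grad => //.
    have t1 : t%:R * a j <= (u i)%:R * a j.
      by rewrite ler_pM2r// ler_nat ltnW.
    have t0 : 0 <= t%:R * a j by rewrite mulr_ge0// ltW.
    by have := uL i; rewrite mulrN => ?; apply/andP; split; lra.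
  have h2 : `|h (X - (u i)%:R * a j + (v i)%:R * a k) - h (X - (u i)%:R * a j)|
      <= (v i)%:R * e.
    apply: dist_iter_le => t tv; rewrite distrC.
    set z := X - _ + _.
    rewrite -{1}(addrK (a k) z); apply: (grad k (z + a k)) => //.
    have t1 : t.+1%:R * a k <= (v i)%:R * a k.
      by rewrite ler_pM2r// ler_nat.
    have t0 : 0 <= t%:R * a k by rewrite mulr_ge0// ltW.
    have := uL i; rewrite -natr1 /z /y in t1 yl *.
    by have := a0 k => ? ?; apply/andP; split; lra.
  apply: (@le_trans _ _ ((u i + v i)%:R * e)); last by rewrite ler_wpM2r.
  rewrite natrD mulrDl [leRHS]addrC; apply: le_trans (lerD h2 h1).
  rewrite mulrN (le_trans _ (ler_normD _ _))// le_eqVlt; apply/orP; left; apply/eqP.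
  by congr `|_|; rewrite /y (_ : X - (_ - _) = X - (u i)%:R * a j + (v i)%:R * a k); ring.
have B0 : 0 <= q%:R * B.
  apply: le_trans (fB L _); last by apply/andP; split; lra.
  by apply: sumr_ge0 => i _; case/andP: (f01 (L - y i)).
have hsum : \sum_i h (X - y i) <= q%:R * B * (1 + (M + 2 * Y) / m).
  apply: harmonic_ext_sum_le => //.
  - by move=> z; case/andP: (g01 z).
  - by move=> z zL; rewrite /g zL.
  - move=> z zL; apply: le_trans (fB z zL); apply: ler_sum => i _.
    by rewrite /g; case: ifP => // _; case/andP: (f01 (z - y i)).
have fh : f X <= h X.
  apply: harmonic_ext_ge maM fsub _ _ => // [z /andP[zL _]|].
    by rewrite /g ltNge zL.
  by apply/andP; split; lra.
apply: le_trans fh _.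
rewrite -(ler_pM2l q0') mulrDr mulrA.
have -> : q%:R * h X = \sum_(i < q) h X.
  by rewrite sumr_const card_ord mulr_natl.
have -> : q%:R * (W * e) = \sum_(i < q) W * e.
  by rewrite sumr_const card_ord mulr_natl.
apply: le_trans (lerD hsum (lexx _)); rewrite -big_split/=; apply: ler_sum => i _.
by have := dist i; rewrite ler_norml => /andP[? _]; lra.
Qed.

(** * Fourier transforms of self-similar measures *)

Lemma bounded_integrable (d : measure_display) (T : measurableType d)
    (R : realType) (mu : probability T R) (f : T -> R) (B : R) :
  measurable_fun setT f -> (forall x, `|f x| <= B) ->
  mu.-integrable setT (EFin \o f).
Proof.
move=> mf fB; apply: measurable_bounded_integrable => //.
  by rewrite ltey_eq fin_num_measure.
exists B; split; first exact: num_real.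
by move=> M BM x _ /=; apply: le_trans (fB x) _; exact: ltW.
Qed.

Lemma expectation_cst (d : measure_display) (T : measurableType d)
    (R : realType) (mu : probability T R) (c : R) : \int[mu]_x c = c.
Proof. by rewrite Rintegral_cst// [X in fine X](probability_setT mu) mulr1. Qed.

Lemma Rintegral_full (d : measure_display) (T : measurableType d)
    (R : realType) (mu : probability T R) (D : set T) (f : T -> R) :
  measurable D -> mu D = 1%E -> mu.-integrable setT (EFin \o f) ->
  \int[mu]_x f x = \int[mu]_(x in D) f x.
Proof.
move=> mD D1 fi; rewrite /Rintegral (@negligible_integral _ _ _ _ setT (~` D))//.
- by rewrite setTD setCK.
- exact: measurableC.
- by rewrite [LHS](probability_setC mu)// D1 subee.
Qed.

Lemma le_expectation (d : measure_display) (T : measurableType d)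
    (R : realType) (mu : probability T R) (D : set T) (f g : T -> R) :
  measurable D -> mu D = 1%E -> mu.-integrable setT (EFin \o f) ->
  mu.-integrable setT (EFin \o g) -> (forall x, D x -> f x <= g x) ->
  \int[mu]_x f x <= \int[mu]_x g x.
Proof.
move=> mD D1 fi gi fg; rewrite !(Rintegral_full _ _ _ _ D)//.
apply: le_Rintegral => //; exact: integrableS (subsetT _) _.
Qed.

Lemma EFin_expectation (d : measure_display) (T : measurableType d)
    (R : realType) (mu : probability T R) (f : T -> R) :
  mu.-integrable setT (EFin \o f) ->
  (\int[mu]_x f x)%:E = (\int[mu]_x (f x)%:E)%E.
Proof. by move=> fi; rewrite /Rintegral fineK// integrable_fin_num. Qed.

Lemma expectation_sum (d : measure_display) (T : measurableType d)
    (R : realType) (mu : probability T R) (I : finType) (f : I -> T -> R) :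
  (forall i, mu.-integrable setT (EFin \o f i)) ->
  \int[mu]_x (\sum_i f i x) = \sum_i \int[mu]_x f i x.
Proof.
move=> fi; apply: EFin_inj; rewrite -sumEFin.
under [RHS]eq_bigr do rewrite EFin_expectation//.
rewrite -integral_sum// /Rintegral.
under [in LHS]eq_integral do rewrite -sumEFin.
by rewrite fineK// integrable_fin_num//; apply: integrable_sum => // i _; exact: fi.
Qed.

(** The identity on sets says that [mu] is a finite sum of scaled pushforwards of itself, and
    integrals follow that decomposition. *)
Lemma self_similar_expectation (d : measure_display) (T : measurableType d)
    (R : realType) (A : finType) (w0 : A) (f : A -> T -> T) (p : A -> R)
    (mu : probability T R) (g : T -> R) :
  (forall w, 0 <= p w) -> \sum_w p w = 1 ->
  (forall w, measurable_fun setT (f w)) ->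
  (forall B : set T, measurable B ->
     mu B = (\sum_w (p w)%:E * mu (f w @^-1` B))%E) ->
  measurable_fun setT g -> (forall x, `|g x| <= 1) ->
  \int[mu]_x g x = \sum_w p w * \int[mu]_x g (f w x).
Proof.
move=> p0 p1 mf mu_ss mg g1.
have mgf w : measurable_fun setT (g \o f w) by exact: measurableT_comp.
(* The rules for sums and pushforwards of measures are applied to nonnegative integrands; since
   [|g| <= 1], adding 1 is enough. *)
pose h x := g x + 1.
have h0 x : 0 <= h x by have := g1 x; rewrite ler_norml /h => /andP[? _]; lra.
have mh : measurable_fun setT h by exact: measurable_funD.
have hE (k : T -> R) : measurable_fun setT k -> (forall x, `|k x| <= 1) ->
    (\int[mu]_x (k x + 1)%:E)%E = (\int[mu]_x k x + 1)%:E.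
  move=> mk k1; have ki := bounded_integrable _ _ _ mu k 1 mk k1.
  have ci : mu.-integrable setT (EFin \o (fun=> 1 : R)).
    by apply: (@bounded_integrable _ _ _ _ _ 1) => // x; rewrite normr1.
  rewrite -[X in _ + X](expectation_cst _ _ _ mu 1) -RintegralD//.
  rewrite EFin_expectation//; apply: (@bounded_integrable _ _ _ _ _ 2) => [|x].
    exact: measurable_funD.
  by rewrite (le_trans (ler_normD _ _))// normr1 -lerBrDr (le_trans (k1 x))//; lra.
suff : (\int[mu]_x (h x)%:E = \sum_w (p w)%:E * \int[mu]_x (h (f w x))%:E)%E.
  rewrite hE//.
  have -> : (\sum_w (p w)%:E * \int[mu]_x (h (f w x))%:E =
      \sum_w (p w * (\int[mu]_x g (f w x)) + p w)%:E)%E.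
    apply: eq_bigr => w _; rewrite -{3}[p w]mulr1 -mulrDr EFinM; congr (_ * _)%E.
    by apply: (hE (g \o f w)) => // x; exact: g1.
  by rewrite sumEFin big_split/= p1 => H; apply: (@addIr _ 1); exact: EFin_inj H.
(* [msum] is indexed by naturals, so the alphabet is enumerated; [w0] is only the default of
   [nth]. *)
pose W n := nth w0 (enum A) n.
have WE (F : A -> \bar R) : (\sum_w F w = \sum_(k < #|A|) F (W k))%E.
  by rewrite -big_enum/= (big_nth w0) big_mkord -cardE.
pose m' n : {measure set T -> \bar R} :=
  mscale (NngNum (p0 (W n))) (pushforward mu (f (W n))).
pose m := m' (fun n => mf (W n)).
have muE B : measurable B -> mu B = msum m #|A| B.
  by move=> mB; rewrite mu_ss// WE.
rewrite (eq_measure_integral (msum m #|A|)); last by move=> B mB _; exact: muE.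
have mEh : measurable_fun setT (fun x => (h x)%:E) by exact/measurable_EFinP.
have h0' x : setT x -> (0 <= (h x)%:E)%E by rewrite lee_fin.
rewrite ge0_integral_measure_sum// WE; apply: eq_bigr => k _.
rewrite ge0_integral_mscale// ge0_integral_pushforward//.
by move=> y _; rewrite lee_fin.
Qed.

Lemma expectation_lin (d : measure_display) (T : measurableType d)
    (R : realType) (mu : probability T R) (f g : T -> R) (s t : R) :
  mu.-integrable setT (EFin \o f) -> mu.-integrable setT (EFin \o g) ->
  \int[mu]_x (s * f x + t * g x) = s * \int[mu]_x f x + t * \int[mu]_x g x.
Proof.
move=> fi gi.
have sc (c : R) (h : T -> R) : mu.-integrable setT (EFin \o h) ->
    mu.-integrable setT (EFin \o (fun x => c * h x)).
  by move=> hi; apply: (eq_integrable measurableT _ _ _ (integrableZl measurableT c hi)).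
by rewrite RintegralD// ?RintegralZl//; exact: sc.
Qed.

(** * Trigonometric integrals and the squared modulus of the transform *)

Lemma trig_integrable (R : realType) (mu : probability (measurableTypeR R) R)
    (s c : R) :
  mu.-integrable setT (EFin \o (fun x => cos (s * x + c))) /\
  mu.-integrable setT (EFin \o (fun x => sin (s * x + c))).
Proof.
have ca : continuous (fun x : R => s * x + c).
  by move=> x; apply: cvgD; [apply: cvgM; [exact: cvg_cst|exact: cvg_id]|exact: cvg_cst].
split; apply: (@bounded_integrable _ _ _ _ _ 1).
- apply: continuous_measurable_fun => x.
  by apply: continuous_comp; [exact: ca|exact: continuous_cos].
- by move=> x; exact: cos_max.
- apply: continuous_measurable_fun => x.
  by apply: continuous_comp; [exact: ca|exact: continuous_sin].
- by move=> x; exact: sin_max.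
Qed.

Definition cos_transform (R : realType) (mu : probability (measurableTypeR R) R)
  (t : R) : R := \int[mu]_x cos (t * x).

Definition sin_transform (R : realType) (mu : probability (measurableTypeR R) R)
  (t : R) : R := \int[mu]_x sin (t * x).

(** The frequency is angular: the squared modulus of the Fourier transform at [xi] is
    [energy mu (2 * pi * xi)]. *)
Definition energy (R : realType) (mu : probability (measurableTypeR R) R)
  (t : R) : R := cos_transform R mu t ^+ 2 + sin_transform R mu t ^+ 2.

Arguments cos_transform {R} mu t.
Arguments sin_transform {R} mu t.
Arguments energy {R} mu t.

Lemma trig_integrable0 (R : realType) (mu : probability (measurableTypeR R) R)
    (s : R) :
  mu.-integrable setT (EFin \o (fun x => cos (s * x))) /\
  mu.-integrable setT (EFin \o (fun x => sin (s * x))).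
Proof.
have [ci si] := trig_integrable R mu s 0.
split.
  by apply: (eq_integrable measurableT _ _ _ ci) => // x _ /=; rewrite addr0.
by apply: (eq_integrable measurableT _ _ _ si) => // x _ /=; rewrite addr0.
Qed.

Lemma cos_transform_shift (R : realType)
    (mu : probability (measurableTypeR R) R) (t c : R) :
  \int[mu]_x cos (t * x + c) =
  cos c * cos_transform mu t - sin c * sin_transform mu t.
Proof.
have [ci si] := trig_integrable0 R mu t.
rewrite -mulNr -expectation_lin//; apply: eq_Rintegral => x _.
by rewrite cosD; ring.
Qed.

Lemma sin_transform_shift (R : realType)
    (mu : probability (measurableTypeR R) R) (t c : R) :
  \int[mu]_x sin (t * x + c) =
  sin c * cos_transform mu t + cos c * sin_transform mu t.
Proof.
have [ci si] := trig_integrable0 R mu t.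
rewrite -expectation_lin//; apply: eq_Rintegral => x _.
by rewrite sinD; ring.
Qed.

Lemma energyE (R : realType) (mu : probability (measurableTypeR R) R) (t : R) :
  energy mu t =
  \int[mu]_x (cos_transform mu t * cos (t * x) + sin_transform mu t * sin (t * x)).
Proof.
have [ci si] := trig_integrable0 R mu t.
by rewrite expectation_lin// /energy !expr2.
Qed.

Lemma energy_ge0 (R : realType) (mu : probability (measurableTypeR R) R) (t : R) :
  0 <= energy mu t.
Proof. by rewrite addr_ge0// sqr_ge0. Qed.

Lemma energy_integrand_integrable (R : realType)
    (mu : probability (measurableTypeR R) R) (t : R) :
  mu.-integrable setT (EFin \o (fun x =>
    cos_transform mu t * cos (t * x) + sin_transform mu t * sin (t * x))).
Proof.
have [ci si] := trig_integrable0 R mu t.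
apply: (eq_integrable measurableT _ _ _ (integrableD measurableT
  (integrableZl measurableT (cos_transform mu t) ci)
  (integrableZl measurableT (sin_transform mu t) si))) => //.
Qed.

(** Applying [2 u v <= u^2 + v^2] under the integral of [energyE] gives [E <= (E + 1) / 2]. *)
Lemma energy_le1 (R : realType) (mu : probability (measurableTypeR R) R) (t : R) :
  energy mu t <= 1.
Proof.
suff : energy mu t <= (energy mu t + 1) / 2 by lra.
rewrite {1}energyE -[leRHS](expectation_cst _ _ _ mu).
apply: (le_expectation _ _ _ _ setT) => //.
- exact: probability_setT.
- exact: energy_integrand_integrable.
- by apply: (@bounded_integrable _ _ _ _ _ `|(energy mu t + 1) / 2|).
move=> x _; rewrite /energy; set C := cos_transform _ _; set S := sin_transform _ _.
have := cos2Dsin2 (t * x); have := sqr_ge0 (C - cos (t * x)).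
by have := sqr_ge0 (S - sin (t * x)); rewrite !sqrrB; lra.
Qed.

(** The translation part of each map rotates the pair of cosine and sine transforms by the angle
    [t * b w], which preserves its norm; Jensen's inequality is then applied to each coordinate. *)
Lemma energy_subharmonic (R : realType) (A : finType) (w0 : A)
    (p r b : A -> R) (mu : probability (measurableTypeR R) R) (t : R) :
  (forall w, 0 <= p w) -> \sum_w p w = 1 ->
  (forall B : set (measurableTypeR R), measurable B ->
    mu B = (\sum_w (p w)%:E * mu (similitude (r w) (b w) @^-1` B))%E) ->
  energy mu t <= \sum_w p w * energy mu (r w * t).
Proof.
move=> p0 p1 mu_ss.
have ms w : measurable_fun setT
    (similitude (r w) (b w) : measurableTypeR R -> measurableTypeR R).
  apply: continuous_measurable_fun => x.
  by apply: cvgD; [apply: cvgM; [exact: cvg_cst|exact: cvg_id]|exact: cvg_cst].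
have mtrig (f : R -> R) : continuous f ->
    measurable_fun setT (fun x : measurableTypeR R => f (t * x)).
  move=> cf; apply: continuous_measurable_fun => x.
  by apply: continuous_comp; [apply: cvgM; [exact: cvg_cst|exact: cvg_id]|exact: cf].
have self (f : R -> R) : continuous f -> (forall x, `|f x| <= 1) ->
    \int[mu]_x f (t * x) = \sum_w p w * \int[mu]_x f (r w * t * x + t * b w).
  move=> cf f1.
  rewrite (self_similar_expectation _ _ _ _ w0 _ p mu (fun x => f (t * x)) p0 p1 ms mu_ss)//.
    apply: eq_bigr => w _; congr (_ * _); apply: eq_Rintegral => x _.
    by congr f; rewrite /similitude; ring.
  exact: mtrig.
rewrite {1}/energy /cos_transform /sin_transform.
rewrite (self cos) ?(self sin)//; [|exact: continuous_sin|exact: sin_max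
  |exact: continuous_cos|exact: cos_max].
apply: le_trans (lerD (sqr_avg_le _ _ _ _ p0 p1) (sqr_avg_le _ _ _ _ p0 p1)) _.
rewrite -big_split/=; apply: ler_sum => w _; rewrite -mulrDr ler_wpM2l//.
rewrite cos_transform_shift sin_transform_shift /energy le_eqVlt; apply/orP; left.
by apply/eqP; have := cos2Dsin2 (t * b w) => E; rewrite -[RHS]mul1r -E; ring.
Qed.

(* [energyE] and the addition formula write [energy mu t] as the iterated
   integral of [cos (t * (y - x))]; only the inner one needs estimating. *)
Lemma energy_sum_le (R : realType) (mu : probability (measurableTypeR R) R)
    (D : set R) (I : finType) (xi : I -> R) (K Q rho m : R) :
  measurable (D : set (measurableTypeR R)) -> mu D = 1%E ->
  0 <= Q ->
  (forall x y, D x -> D y ->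
    \sum_i cos (xi i * (y - x)) <= K + Q * (`|y - x| <= rho)%R%:R) ->
  (forall x, D x -> (mu [set` `[x - rho, x + rho]%R] <= m%:E)%E) ->
  \sum_i energy mu (xi i) <= K + Q * m.
Proof.
move=> mD D1 Q0 KQ mum.
under eq_bigr do rewrite energyE.
rewrite -expectation_sum; last by move=> i; exact: energy_integrand_integrable.
rewrite -[leRHS](expectation_cst _ _ _ mu).
apply: (@le_expectation _ (measurableTypeR R) R mu D) => //.
- have := integrable_sum measurableT (index_enum I) (P := xpredT)
    (fun i _ => energy_integrand_integrable R mu (xi i)).
  apply: eq_integrable => // x _ /=.
  by rewrite sumEFin.
- by apply: (@bounded_integrable _ _ _ _ _ `|K + Q * m|).
move=> x Dx.
have -> : \sum_i (cos_transform mu (xi i) * cos (xi i * x) +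
    sin_transform mu (xi i) * sin (xi i * x)) =
    \int[mu]_y (\sum_i cos (xi i * y + - (xi i * x))).
  rewrite expectation_sum => [|i]; last first.
    by case: (trig_integrable R mu (xi i) (- (xi i * x))).
  by apply: eq_bigr => i _; rewrite cos_transform_shift cosN sinN; ring.
set J := `[x - rho, x + rho]%classic.
have mJ : measurable (J : set (measurableTypeR R)) by exact: measurable_itv.
have Ji : mu.-integrable setT (EFin \o (\1_J : R -> R)).
  apply: (@bounded_integrable _ _ _ _ _ 1) => [|y].
    exact: measurable_indic.
  by rewrite indicE; case: (_ \in _); rewrite ?normr1 ?normr0.
have ci : mu.-integrable setT (EFin \o (fun=> 1 : R)).
  by apply: (@bounded_integrable _ _ _ _ _ 1) => // y; rewrite normr1.
apply: (@le_trans _ _ (\int[mu]_y (K * 1 + Q * \1_J y))); last first.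
  rewrite expectation_lin// expectation_cst mulr1 lerD2l ler_wpM2l//.
  rewrite -lee_fin EFin_expectation// integral_indic// setIT.
  exact: mum.
apply: (@le_expectation _ (measurableTypeR R) R mu D) => //.
- have := integrable_sum measurableT (index_enum I) (P := xpredT)
    (fun i _ => (trig_integrable R mu (xi i) (- (xi i * x))).1).
  apply: eq_integrable => // y _ /=.
  by rewrite sumEFin.
- apply: (eq_integrable measurableT _ _ _ (integrableD measurableT
    (integrableZl measurableT K ci) (integrableZl measurableT Q Ji))) => //.
move=> y Dy; have := KQ x y Dx Dy; rewrite mulr1 indicE.
have -> : (y \in J) = (`|y - x| <= rho).
  by rewrite /J mem_setE/= in_itv/= ler_distl.
by under [in X in X -> _]eq_bigr do rewrite mulrBr.
Qed.

(** Balls are cut down to [0, 1], where [mu] lives, to become admissible intervals. For large radii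
    the trivial bound 1 is absorbed into the constant. *)
Lemma mass_of_balls (R : realType) (mu : probability (measurableTypeR R) R)
    (alpha : R) :
  mu `[0%R, 1%R]%classic = 1%E -> upper_regularity_exponent mu alpha ->
  exists2 C : R, 0 <= C & forall x rho : R, 0 <= x <= 1 -> 0 < rho ->
    (mu [set` `[x - rho, x + rho]%R] <= (C * rho `^ alpha)%:E)%E.
Proof.
move=> mu1 [/andP[a0 a1] [C [r0 [C0 r00 Cr]]]].
(* The first summand serves [2 rho < r0], where the diameter is at most [2 rho]; the second makes
   the bound at least 1 once [rho >= r0 / 2]. *)
exists (C * 2 `^ alpha + (r0 / 2) `^ (- alpha)).
  by rewrite addr_ge0// ?powR_ge0// mulr_ge0 ?powR_ge0// ltW.
move=> x rho /andP[x0 x1] rho0; set B := [set` _]; pose D := `[0 : R, 1]%classic.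
have mB : measurable (B : set (measurableTypeR R)) by exact: measurable_itv.
have mD : measurable (D : set (measurableTypeR R)) by exact: measurable_itv.
have muB : mu B = mu (B `&` D).
  have muDC : mu (~` D) = 0%E by rewrite [LHS](probability_setC mu)// mu1 subee.
  rewrite [LHS](measureDI mu mB mD) [X in (X + _)%E](_ : _ = 0%E) ?add0e//.
  apply: (subset_measure0 _ _ _ muDC); [exact: measurableD|exact: measurableC|].
  exact: subIsetr.
rewrite muB.
have rp : 0 <= rho `^ alpha by exact: powR_ge0.
have r20 : 0 < r0 / 2 by rewrite divr_gt0.
have [rr|rr] := ltP (2 * rho) r0; last first.
  apply: le_trans (probability_le1 _ _) _; first exact: measurableI.
  rewrite lee_fin mulrDl.
  apply: (@le_trans _ _ ((r0 / 2) `^ (- alpha) * rho `^ alpha)); last first.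
    by rewrite lerDr mulr_ge0// mulr_ge0 ?powR_ge0// ltW.
  rewrite powRN mulrC ler_pdivlMr ?powR_gt0// mul1r.
  rewrite ge0_ler_powR// ?nnegrE ?(ltW r20) ?(ltW rho0)//.
  by lra.
have BDx : (B `&` D) x by split; rewrite /B /D /= in_itv/=; apply/andP; split; lra.
have d_ub : ubound [set `|u - v| | u in B `&` D & v in B `&` D] (2 * rho).
  move=> _ [u [+ _]] [v [+ _]] <-; rewrite /B /= !in_itv/= => /andP[? ?] /andP[? ?].
  by rewrite ler_norml; apply/andP; split; lra.
have d_mem : [set `|u - v| | u in B `&` D & v in B `&` D] 0.
  by exists x => //; exists x => //; rewrite subrr normr0.
have d_le : diam (B `&` D) <= 2 * rho by apply: ge_sup => //; exists 0.
have d_ge : 0 <= diam (B `&` D) by apply: ub_le_sup => //; exists (2 * rho).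
have d_int : is_interval (B `&` D).
  move=> u v [+ +] [+ +] z; rewrite /B /D /= !in_itv/=.
  move=> /andP[? ?] /andP[? ?] /andP[? ?] /andP[? ?] /andP[? ?].
  by split => /=; rewrite ?in_itv/=; apply/andP; split; lra.
have d_lt : diam (B `&` D) < r0 by exact: le_lt_trans rr.
apply: le_trans (Cr _ d_int (@subIsetr _ _ _) d_lt) _.
rewrite lee_fin mulrDl (@le_trans _ _ (C * 2 `^ alpha * rho `^ alpha))//; last first.
  by rewrite lerDl mulr_ge0// powR_ge0.
rewrite -mulrA ler_wpM2l ?(ltW C0)// -powRM// ?(ltW rho0)//.
by rewrite ge0_ler_powR// nnegrE mulr_ge0// ltW.
Qed.

(** Near the diagonal each cosine is bounded by 1. Off it the cosine sum estimate applies at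
    frequency [2 pi e^z |d|]: the upper bound on [z] controls the discretization error, and the
    lower bound together with [|d| > rho] controls the oscillating part. *)
Lemma cos_kernel_sum_le (R : realType) (b M Y s rho z d : R) (p q : nat)
    (y : 'I_q -> R) :
  0 < b -> (0 < q)%N -> coprime p q -> 0 < s -> 0 < rho ->
  (forall n : 'I_q, `|y n - b * (n * p %% q)%N%:R / q%:R| <= b / q%:R) ->
  ln s - M - Y <= z <= ln s + Y -> `|d| <= 1 ->
  \sum_(n < q) cos (2 * pi * expR (z - y n) * d) <=
  expR b * (4 * pi * b * expR Y * s +
            (2 / b + 1) / (2 * pi) * expR (M + Y) * (q%:R / (s * rho))) +
  q%:R * (`|d| <= rho)%R%:R.
Proof.
move=> b0 q0 cpq s0 rho0 yb /andP[z1 z2] d1.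
have pi0 := pi_gt0 R.
have q0' : 0 < q%:R :> R by rewrite ltr0n.
set K1 := 4 * pi * b * expR Y * s.
set K2 := (2 / b + 1) / (2 * pi) * expR (M + Y) * (q%:R / (s * rho)).
have b20 : 0 < 2 / b + 1 by rewrite addr_gt0// divr_gt0.
have K10 : 0 <= K1 by rewrite !mulr_ge0 ?expR_ge0// ltW.
have K20 : 0 <= K2.
  by rewrite mulr_ge0 ?mulr_ge0 ?expR_ge0 ?invr_ge0 ?mulr_ge0// ltW.
have [dr|dr] := leP `|d| rho.
  apply: (@le_trans _ _ (\sum_(n < q) 1)).
    apply: ler_sum => n _; have := cos_max (2 * pi * expR (z - y n) * d).
    by rewrite ler_norml => /andP[].
  by rewrite sumr_const card_ord mulr1 lerDr mulr_ge0 ?expR_ge0// addr_ge0.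
rewrite mulr0 addr0.
have d0 : 0 < `|d| by exact: lt_trans dr.
pose l := 2 * pi * expR z * `|d|.
have l0 : 0 < l by rewrite !mulr_gt0 ?expR_gt0.
have -> : \sum_(n < q) cos (2 * pi * expR (z - y n) * d) =
    \sum_(n < q) cos (l * expR (- y n)).
  apply: eq_bigr => n _; rewrite -cos_norm; congr cos.
  rewrite normrM ger0_norm ?mulr_ge0 ?expR_ge0// ?(ltW pi0)//.
  by rewrite expRD /l; ring.
apply: le_trans (ler_norm _) _.
apply: le_trans (cos_expR_sum_le _ _ _ _ _ _ b0 l0 q0 cpq yb) _.
rewrite ler_wpM2l ?expR_ge0// lerD//.
- have : l <= 2 * pi * (expR Y * s).
    rewrite /l -mulrA ler_pM2l ?mulr_gt0// -[leRHS]mulr1 ler_pM ?expR_ge0//.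
    by rewrite -{1}(lnK s0) -expRD ler_expR addrC.
  move=> /(ler_wpM2r (ltW b0)) lb; rewrite /K1; lra.
- have lK : 2 * pi * expR (- (M + Y)) * (s * rho) <= l.
    rewrite (_ : _ * (s * rho) = 2 * pi * (expR (- (M + Y)) * s * rho)); last by ring.
    rewrite /l -[leRHS]mulrA ler_pM2l ?mulr_gt0//.
    rewrite ler_pM ?mulr_ge0 ?expR_ge0 ?(ltW s0) ?(ltW rho0) ?(ltW dr)//.
    by rewrite -{1}(lnK s0) -expRD ler_expR; lra.
  have sr : 0 < s * rho by rewrite mulr_gt0.
  have -> : K2 = (2 / b + 1) / (2 * pi * expR (- (M + Y)) * (s * rho)) * q%:R.
    rewrite /K2 expRN; move: (@pi R) (pi_gt0 R) => P P0; field.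
    by rewrite !gt_eqF ?expR_gt0.
  rewrite ler_pM2r// ler_pM2l// lef_pV2// posrE// mulr_gt0// mulr_gt0 ?expR_gt0//.
  by rewrite mulr_gt0.
Qed.

(** * Decay of the Fourier transform *)

(** Euclidean division of [n p] by [q] leaves exactly the error [(b / q) n (q a / b - p)], and
    [n < q <= Q]. *)
Lemma lattice_point_dist (R : realType) (a b : R) (p q Q n : nat) :
  0 < b -> (0 < q <= Q)%N -> (n < q)%N ->
  `|q%:R * (a / b) - p%:R| <= Q%:R^-1 ->
  `|n%:R * a - (n * p %/ q)%N%:R * b - b * (n * p %% q)%N%:R / q%:R| <= b / q%:R.
Proof.
move=> b0 /andP[q0 qQ] nq pq.
have q0' : 0 < q%:R :> R by rewrite ltr0n.
have np : n%:R * p%:R = (n * p %/ q)%N%:R * q%:R + (n * p %% q)%N%:R :> R.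
  by rewrite -!natrM -natrD -divn_eq.
set u := (n * p %/ q)%N%:R in np *; set v := (n * p %% q)%N%:R in np *.
have -> : n%:R * a - u * b - b * v / q%:R =
    b / q%:R * (n%:R * (q%:R * (a / b) - p%:R)).
  have -> : v = n%:R * p%:R - u * q%:R by rewrite np addrAC subrr add0r.
  by field; rewrite !gt_eqF.
have bq : 0 < b / q%:R by rewrite divr_gt0.
rewrite normrM (gtr0_norm bq) -[leRHS]mulr1 ler_pM2l//.
rewrite normrM ger0_norm//.
have Q0 : 0 < Q%:R :> R by rewrite ltr0n (leq_trans q0).
apply: le_trans (ler_wpM2l (ler0n _ _) pq) _.
by rewrite ler_pdivrMr// mul1r ler_nat (leq_trans (ltnW nq)).
Qed.

(** Four errors add up: discretization [s / q], oscillation [1 / (s rho)], mass near the diagonal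
    [rho^alpha], and the cost [q e] of O(q) shifts of the starting point. *)
Lemma energy_le_errors (R : realType) (A : finType) (P a r b : A -> R)
    (mu : probability (measurableTypeR R) R) (j k : A) (alpha m M : R) :
  (forall w, 0 <= P w) -> \sum_w P w = 1 ->
  (forall B : set (measurableTypeR R), measurable B ->
    mu B = (\sum_w (P w)%:E * mu (similitude (r w) (b w) @^-1` B))%E) ->
  (forall w, r w = expR (- a w)) -> 0 < m -> (forall w, m <= a w <= M) ->
  mu `[0%R, 1%R]%classic = 1%E -> upper_regularity_exponent mu alpha ->
  exists2 C : R, 0 <= C & forall (p q Q N : nat) (s rho e X : R),
    (0 < q <= Q)%N -> coprime p q ->
    `|q%:R * (a j / a k) - p%:R| <= Q%:R^-1 ->
    0 < s -> 0 < rho -> 0 <= e ->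
    1 <= N%:R * P j * e ^+ 2 -> 1 <= N%:R * P k * e ^+ 2 ->
    ln s + N.+1%:R * M + q%:R * a j <= X ->
    energy mu (2 * pi * expR X) <=
    C * (s / q%:R + (s * rho)^-1 + rho `^ alpha + q%:R * e).
Proof.
move=> P0 P1 mu_ss ra m0 maM mu1 mu_reg.
have [C2 C20 mu_ball] := mass_of_balls R mu alpha mu1 mu_reg.
have a0 w : 0 < a w by apply: lt_le_trans m0 _; case/andP: (maM w).
have M0 : 0 <= M by apply: le_trans (ltW (a0 j)) _; case/andP: (maM j).
have bk0 := a0 k; have pi0 := pi_gt0 R.
(* Each [y n] is within [a k / q] of a point of [0, a k]. *)
pose Y := 2 * a k; have Y0 : 0 <= Y by rewrite mulr_ge0// ltW.
pose c1 := expR (a k) * (4 * pi * a k * expR Y).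
pose c2 := expR (a k) * ((2 / a k + 1) / (2 * pi) * expR (M + Y)).
pose c3 := 1 + (M + 2 * Y) / m.
pose t := a j / a k.
have t0 : 0 < t by rewrite divr_gt0.
have c10 : 0 <= c1 by rewrite !mulr_ge0 ?expR_ge0// ltW.
have c20 : 0 <= c2.
  rewrite mulr_ge0 ?expR_ge0// mulr_ge0 ?expR_ge0// divr_ge0//.
    by rewrite addr_ge0// divr_ge0// ltW.
  by rewrite mulr_ge0// ltW.
have c30 : 0 <= c3 by rewrite addr_ge0// divr_ge0 ?(ltW m0)// addr_ge0// mulr_ge0.
exists ((c1 + c2 + C2) * c3 + (2 + t)).
  apply: addr_ge0; last by rewrite addr_ge0// ltW.
  by apply: mulr_ge0 => //; apply: addr_ge0 => //; exact: addr_ge0.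
move=> p q Q N s rho e X /andP[q0 qQ] cpq pq s0 rho0 e0 Nj Nk NX.
have q0' : 0 < q%:R :> R by rewrite ltr0n.
have Q0 : (0 < Q)%N := leq_trans q0 qQ.
pose f (x : R) := energy mu (2 * pi * expR x).
have f01 x : 0 <= f x <= 1 by rewrite energy_ge0 energy_le1.
have fsub x : f x <= \sum_w P w * f (x - a w).
  rewrite (le_trans (energy_subharmonic _ _ j P r b mu _ P0 P1 mu_ss))//.
  rewrite le_eqVlt; apply/orP; left; apply/eqP; apply: eq_bigr => w _.
  congr (_ * _); rewrite /f ra expRD.
  by congr energy; ring.
pose u (n : 'I_q) : nat := n; pose v (n : 'I_q) : nat := (n * p %/ q)%N.
pose y n := (u n)%:R * a j - (v n)%:R * a k.
have yb n : `|y n - a k * (n * p %% q)%N%:R / q%:R| <= a k / q%:R.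
  by apply: (lattice_point_dist _ _ _ _ _ Q); rewrite ?q0//; exact: ltn_ord.
have yY n : `|y n| <= Y.
  rewrite -(subrK (a k * (n * p %% q)%N%:R / q%:R) (y n)).
  apply: le_trans (ler_normD _ _) _.
  have -> : Y = a k + a k by rewrite /Y; ring.
  rewrite lerD//.
    apply: le_trans (yb n) _.
    by rewrite ler_pdivrMr// ler_peMr ?(ltW bk0)// ler1n.
  rewrite ger0_norm ?divr_ge0 ?mulr_ge0 ?(ltW bk0)//.
  by rewrite ler_pdivrMr// ler_pM2l// ler_nat ltnW// ltn_mod.
have p_le : p%:R <= q%:R * t + 1.
  move: pq; rewrite ler_norml -/t => /andP[+ _].
  by have : Q%:R^-1 <= 1 :> R by [rewrite invf_le1 ?ler1n// ltr0n]; lra.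
(* Here [u n <= q] and [v n <= p <= q t + 1]; the extra 1 is at most [q]. *)
have uvW n : (u n + v n)%:R <= q%:R * (2 + t).
  have vp : (v n <= p)%N.
    by rewrite /v -[leqRHS](mulKn p q0) leq_div2r// leq_mul2r ltnW ?orbT.
  rewrite natrD; have : (u n)%:R <= q%:R :> R by rewrite ler_nat ltnW// ltn_ord.
  have : (v n)%:R <= p%:R :> R by rewrite ler_nat.
  have : 1 <= q%:R :> R by rewrite ler1n.
  lra.
pose B := c1 * (s / q%:R) + c2 * (s * rho)^-1 + C2 * rho `^ alpha.
have fB z : ln s - M - Y <= z <= ln s + Y -> \sum_(n < q) f (z - y n) <= q%:R * B.
  move=> zL; pose K := expR (a k) * (4 * pi * a k * expR Y * s +
    (2 / a k + 1) / (2 * pi) * expR (M + Y) * (q%:R / (s * rho))).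
  have -> : q%:R * B = K + q%:R * (C2 * rho `^ alpha).
    rewrite /B /K /c1 /c2; move: (@pi R) pi0 => pi' pi'0; field.
    by rewrite !gt_eqF.
  apply: (energy_sum_le _ _ `[0, 1]%classic _ _ _ _ rho) => //.
  - move=> x x' x01 x'01; apply: (cos_kernel_sum_le _ _ _ _ _ _ _ _ p) => //.
    move: x01 x'01; rewrite /= !in_itv/= => /andP[? ?] /andP[? ?].
    by rewrite ler_norml; apply/andP; split; lra.
  - by move=> x x01; apply: mu_ball => //; rewrite /= in_itv in x01.
have := subharmonic_le_avg _ _ P a f j k (ln s) X m M Y (q%:R * (2 + t)) B e N q u v
  q0 P0 P1 m0 maM f01 fsub yY uvW e0 Nj Nk _ fB.
rewrite -/c3 -/(f X).
move=> /(_ _) /le_trans; apply.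
  move=> n; apply: le_trans NX; rewrite lerD2l ler_pM2r//.
  by rewrite ler_nat ltnW// ltn_ord.
rewrite /B; set S1 := s / q%:R; set S2 := (s * rho)^-1; set S3 := rho `^ alpha.
have S10 : 0 <= S1 by rewrite divr_ge0// ltW.
have S20 : 0 <= S2 by rewrite invr_ge0 mulr_ge0// ltW.
have S30 : 0 <= S3 by rewrite powR_ge0.
have S40 : 0 <= q%:R * e by rewrite mulr_ge0.
have -> : q%:R * (2 + t) * e = (2 + t) * (q%:R * e) by ring.
have T0 : 0 <= 2 + t by rewrite addr_ge0// ltW.
rewrite -subr_ge0.
have -> : ((c1 + c2 + C2) * c3 + (2 + t)) * (S1 + S2 + S3 + q%:R * e) -
  ((c1 * S1 + c2 * S2 + C2 * S3) * c3 + (2 + t) * (q%:R * e)) =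
  c1 * c3 * (S2 + S3 + q%:R * e) + c2 * c3 * (S1 + S3 + q%:R * e)
  + C2 * c3 * (S1 + S2 + q%:R * e) + (2 + t) * (S1 + S2 + S3) by ring.
by repeat (first [assumption | apply: addr_ge0 | apply: mulr_ge0]).
Qed.

(** Sums stand in for extrema; [j] witnesses that the alphabet is nonempty. *)
Lemma finite_positive_bounds (R : realType) (A : finType) (a : A -> R) (j : A) :
  (forall w, 0 < a w) ->
  exists m M : R, 0 < m /\ forall w, m <= a w <= M.
Proof.
move=> a0; exists (\sum_w (a w)^-1)^-1, (\sum_w a w).
have s0 : 0 < \sum_w (a w)^-1.
  rewrite (bigD1 j)//= ltr_pwDl ?invr_gt0// sumr_ge0// => w _.
  by rewrite invr_ge0 ltW.
split; first by rewrite invr_gt0.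
move=> w; apply/andP; split.
  rewrite -[leRHS]invrK lef_pV2 ?posrE ?invr_gt0//.
  rewrite (bigD1 w)//= lerDl sumr_ge0// => v _.
  by rewrite invr_ge0 ltW.
by rewrite (bigD1 w)//= lerDl sumr_ge0// => v _; rewrite ltW.
Qed.

(* This choice of the low frequency [s] and of the cutoff [rho] makes the three
   error terms equal. *)
Lemma balanced_errors (R : realType) (x alpha : R) : 0 < x -> 0 <= alpha ->
  let s := x `^ ((1 + alpha) / (1 + 2 * alpha)) in
  let rho := x `^ (- (1 + 2 * alpha)^-1) in
  s / x + (s * rho)^-1 + rho `^ alpha = 3 * x `^ (- (alpha / (1 + 2 * alpha))).
Proof.
move=> x0 al0 s rho.
have d0 : 1 + 2 * alpha != 0 by rewrite gt_eqF// ltr_pwDl// mulr_ge0.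
have xn0 : x != 0 by rewrite gt_eqF.
have -> : s / x = x `^ (- (alpha / (1 + 2 * alpha))).
  rewrite /s -{2}(powRr1 (ltW x0)) -powRB ?xn0 ?implybT//; congr (_ `^ _).
  by field.
have -> : s * rho = x `^ (alpha / (1 + 2 * alpha)).
  by rewrite /s /rho -powRD ?xn0 ?implybT//; congr (_ `^ _); field.
have -> : rho `^ alpha = x `^ (- (alpha / (1 + 2 * alpha))).
  by rewrite /rho -powRrM; congr (_ `^ _); rewrite mulNr mulrC.
by rewrite -powRN; ring.
Qed.

(** With [T = X^(1/4)] the choice is [Q] of order [T], [N] of order [T^4] and [e] of order [T^-2].
    Then [q e] is O(1 / T), and the other errors are a negative power of [q], which the
    non-Liouville condition bounds below by a power of [T]. *)
Lemma energy_decay (R : realType) (A : finType) (P r b : A -> R)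
    (mu : probability (measurableTypeR R) R) (j k : A) (l alpha : R) :
  (forall w, 0 < r w < 1) -> (forall w, 0 < P w) -> \sum_w P w = 1 ->
  (forall B : set (measurableTypeR R), measurable B ->
    mu B = (\sum_w (P w)%:E * mu (similitude (r w) (b w) @^-1` B))%E) ->
  2 <= l -> non_liouville l (ln (r j) / ln (r k)) ->
  mu `[0%R, 1%R]%classic = 1%E -> upper_regularity_exponent mu alpha ->
  exists2 C : R, 0 <= C & exists X0 : R, forall X : R, X0 <= X ->
    energy mu (2 * pi * expR X) <=
    C * X `^ (- (alpha / ((1 + 2 * alpha) * (8 * l - 7)))).
Proof.
move=> r01 P0 P1 mu_ss l2 liou mu1 mu_reg.
have al0 : 0 <= alpha by case: mu_reg => /andP[].
pose a w := - ln (r w).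
have rpos w : r w \is Num.pos by rewrite posrE; case/andP: (r01 w).
have ra w : r w = expR (- a w) by rewrite opprK lnK.
have a0 w : 0 < a w by rewrite oppr_gt0 ln_lt0.
have [m [M [m0 maM]]] := finite_positive_bounds _ _ a j a0.
have M0 : 0 < M by apply: lt_le_trans (a0 j) _; case/andP: (maM j).
have ajM : a j <= M by case/andP: (maM j).
have P0' w : 0 <= P w by exact: ltW.
have [C C0 HC] := energy_le_errors R A P a r b mu j k alpha m M P0' P1 mu_ss ra m0 maM
  mu1 mu_reg.
pose t := a j / a k.
have t0 : 0 < t by rewrite divr_gt0.
have tE : ln (r j) / ln (r k) = t by rewrite /t /a invrN mulrNN.
rewrite tE in liou.
have [c c0 Hc] := convergent_denominator_ge _ _ _ liou.
pose pi0 := P j * P k.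
have pi00 : 0 < pi0 by rewrite mulr_gt0.
have Ple1 w : P w <= 1 by rewrite -P1 (bigD1 w)//= lerDl sumr_ge0.
have pij : pi0 <= P j by rewrite -[leRHS]mulr1 ler_pM2l.
have pik : pi0 <= P k by rewrite -[leRHS]mul1r ler_pM2r.
(* Tuned so that [N pi0 e^2 >= 1] for [e = E0 / T^2] as soon as [N >= X / (8 M)]. *)
pose E0 := Num.sqrt (8 * M / pi0).
have E02 : E0 ^+ 2 = 8 * M / pi0 by rewrite sqr_sqrtr// divr_ge0 ?mulr_ge0// ltW.
have E0ge0 : 0 <= E0 by exact: sqrtr_ge0.
pose ka := alpha / (1 + 2 * alpha).
have d0 : 0 < 1 + 2 * alpha by rewrite ltr_pwDl// mulr_ge0.
have ka0 : 0 <= ka by rewrite divr_ge0// ltW.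
have ka1 : ka <= 1 by rewrite ler_pdivrMr// mul1r; lra.
have l1 : 0 < l - 1 by lra.
have l7 : 0 < 8 * l - 7 by lra.
pose be := alpha / ((1 + 2 * alpha) * (8 * l - 7)).
have beE : be = ka / (8 * l - 7).
  by rewrite /be /ka; field; rewrite !gt_eqF.
exists (C * (3 * c `^ (- (ka / (l - 1))) + 2 * E0)).
  by rewrite mulr_ge0// addr_ge0// mulr_ge0// powR_ge0.
exists ((8 * (1 + M)) ^+ 4) => X XX0.
have X00 : 1 <= (8 * (1 + M)) ^+ 4 by rewrite exprn_ege1//; lra.
have X1 : 1 <= X by exact: le_trans XX0.
have X0 : 0 < X by exact: lt_le_trans X1.
pose T := X `^ (4^-1).
have T4 : T ^+ 4 = X.
  by rewrite -powR_mulrn ?powR_ge0// -powRrM mulVf// powRr1// ltW.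
have T0 : 0 <= T by exact: powR_ge0.
have TM : 8 * (1 + M) <= T.
  by rewrite -(ler_pXn2r (_ : 0 < 4)%N)// ?nnegrE ?T4//; lra.
have Tpos : 0 < T by lra.
pose Q := (Num.truncn T).+1.
have QT : T < Q%:R by exact: truncnS_gt.
have QT2 : Q%:R <= 2 * T.
  rewrite /Q -(natr1 (Num.truncn T)); have : (Num.truncn T)%:R <= T by rewrite truncn_le.
  lra.
have [p [q [/andP[q0 qQ] cpq pq]]] := dirichlet_coprime R t Q (ltW t0) (ltn0Sn _).
have q0' : 0 < q%:R :> R by rewrite ltr0n.
have q1 : 1 <= q%:R :> R by rewrite ler1n.
have qT2 : q%:R <= 2 * T by apply: le_trans QT2; rewrite ler_nat.
pose s := q%:R `^ ((1 + alpha) / (1 + 2 * alpha)).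
pose rho := q%:R `^ (- (1 + 2 * alpha)^-1).
have s0 : 0 < s by exact: powR_gt0.
have rho0 : 0 < rho by exact: powR_gt0.
have lns : ln s <= 2 * T.
  apply: (@le_trans _ _ s).
    have := expR_ge1Dx (ln s); rewrite lnK ?posrE//; lra.
  apply: le_trans qT2; rewrite -[leRHS]powRr1 ?ler0n// ler_powR//.
  by rewrite ler_pdivrMr// mul1r; lra.
pose N := Num.truncn (X / (4 * M)).
have M4 : 0 < 4 * M by rewrite mulr_gt0.
have /andP[N1 N2] : N%:R <= X / (4 * M) < N%:R + 1.
  by rewrite natr1; apply: truncn_itv; rewrite divr_ge0// ltW.
rewrite ler_pdivlMr// in N1; rewrite ltr_pdivrMr// in N2.
have T2T : T <= T ^+ 2 by rewrite expr2 ler_peMl//; lra.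
have T24 : T ^+ 2 <= X.
  rewrite -T4 (_ : T ^+ 4 = T ^+ 2 * T ^+ 2); last by ring.
  by rewrite ler_peMl ?sqr_ge0// exprn_ege1//; lra.
have TMT : 8 * (1 + M) * T <= T ^+ 2 by rewrite expr2 ler_pM2r.
pose e := E0 / T ^+ 2.
have e0 : 0 <= e by rewrite divr_ge0// sqr_ge0.
have eN w : pi0 <= P w -> 1 <= N%:R * P w * e ^+ 2.
  move=> piw; rewrite /e expr_div_n E02 -exprM T4.
  rewrite (_ : N%:R * P w * _ = (N%:R * (8 * M)) * P w / (pi0 * X)); last first.
    by field; rewrite !gt_eqF.
  rewrite ler_pdivlMr ?mulr_gt0// mul1r [leRHS]mulrC ler_pM ?(ltW pi00) ?(ltW X0)//.
  lra.
have := HC p q Q N s rho e X; rewrite q0 qQ -/t.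
move=> /(_ isT cpq pq s0 rho0 e0 (eN j pij) (eN k pik)).
move=> /(_ _)/le_trans; apply.
  (* The descent fits below [X]: [ln s] and [q a j] total at most [2 T (1 + M) <= X / 4], and [N.+1]
     jumps cost at most [X / 4 + M]. *)
  have qa : q%:R * a j <= 2 * T * M by apply: ler_pM => //; exact: ltW.
  rewrite -(natr1 N); lra.
rewrite -mulrA ler_wpM2l// (balanced_errors _ _ _ q0' al0) [leRHS]mulrDl lerD//.
- rewrite -/ka -mulrA ler_pM2l//.
  have -> : c `^ (- (ka / (l - 1))) * X `^ (- be) = (c `^ (ka / (l - 1)) * X `^ be)^-1.
    by rewrite !powRN -invfM.
  rewrite powRN lef_pV2 ?posrE ?mulr_gt0 ?powR_gt0//.
  (* The inequality [c Q <= q^(l - 1)] is raised to the power [ka / (l - 1)]. *)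
  apply: (@le_trans _ _ ((c * Q%:R) `^ (ka / (l - 1)))); last first.
    have kl : 0 <= ka / (l - 1) by rewrite divr_ge0// ltW.
    have := Hc p q Q q0 (ltn0Sn _) pq.
    move=> cQ; apply: le_trans (ge0_ler_powR kl _ _ cQ) _.
    - by rewrite nnegrE mulr_ge0// ltW.
    - by rewrite nnegrE powR_ge0.
    by rewrite -powRrM mulrC divfK// gt_eqF.
  rewrite powRM ?(ltW c0)// ler_wpM2l ?powR_ge0//.
  apply: (@le_trans _ _ (T `^ (ka / (l - 1)))); last first.
    by rewrite ge0_ler_powR ?nnegrE// ?divr_ge0// ltW.
  (* The exponents compare because [4 (l - 1) <= 8 l - 7]. *)
  rewrite -powRrM ler_powR// beE [leRHS]mulrCA ler_wpM2l// -invfM lef_pV2 ?posrE ?mulr_gt0//.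
  lra.
(* [q e <= 2 E0 / T], and [1 / T = X^(-1/4)] suffices since [ka <= 1] and [8 l - 7 >= 4]. *)
- rewrite /e (le_trans (y := 2 * T * (E0 / T ^+ 2)))// ?ler_wpM2r//.
  rewrite (_ : 2 * T * _ = 2 * E0 * T^-1); last by field; rewrite gt_eqF.
  rewrite ler_wpM2l ?mulr_ge0// powRN lef_pV2 ?posrE ?powR_gt0//.
  rewrite /T ler_powR// -/be beE ler_pdivrMr//; lra.
Qed.

(** * From the energy back to the Fourier transform *)

Lemma energy_opp (R : realType) (mu : probability (measurableTypeR R) R) (t : R) :
  energy mu (- t) = energy mu t.
Proof.
rewrite /energy; congr (_ + _).
  by congr (_ ^+ 2); apply: eq_Rintegral => x _; rewrite mulNr cosN.
rewrite /sin_transform -[in RHS]sqrrN; congr (_ ^+ 2).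
have [_ si] := trig_integrable0 R mu t.
rewrite -mulN1r -RintegralZl//; apply: eq_Rintegral => x _.
by rewrite mulNr sinN mulN1r.
Qed.

Lemma norm_fourier (R : realType) (F : set R)
    (mu : probability (measurableTypeR R) R) (xi : R) :
  measurable (F : set (measurableTypeR R)) -> probability_on F mu ->
  `|fourier F mu xi| = (Num.sqrt (energy mu (2 * pi * xi)))%:C%C.
Proof.
move=> mF muF; rewrite normc_def/= -energy_opp /energy; congr (Num.sqrt _)%:C%C.
have [ci si] := trig_integrable0 R mu (- (2 * pi * xi)).
have full f := @Rintegral_full _ (measurableTypeR R) R mu F f mF muF.
rewrite /cos_transform /sin_transform (full _ ci) (full _ si).
by congr (_ ^+ 2 + _ ^+ 2); apply: eq_Rintegral => x _; rewrite mulNr.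
Qed.

Theorem theorem1 (R : realType) (A : finType) (r b : A -> R) (F : set R)
    (hr : forall w, 0 < r w < 1)
    (hb : forall w, 0 <= b w <= 1)
    (hf : forall w, similitude (r w) (b w) @` `[0, 1] `<=` `[0, 1])
    (hF01 : F `<=` `[0, 1])
    (hF : self_similar_set (fun w => similitude (r w) (b w)) F)
    (l : R) (hl : 2 <= l)
    (hjk : exists j k : A, non_liouville l (ln (r j) / ln (r k)))
    (mu : probability (measurableTypeR R) R)
    (hmuF : probability_on F mu)
    (hmu : self_similar_measure (fun w => similitude (r w) (b w)) mu)
    (alpha : R) (halpha : upper_regularity_exponent mu alpha) :
  let decay (xi : R) : R :=
    ln `|xi| `^ (- (alpha / (2 * (1 + 2 * alpha) * (8 * l - 7)))) in
  (fourier F mu : R -> R[i]^o) =O_+oo (fun xi : R => (decay xi)%:C%C : R[i]^o) /\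
  (fourier F mu : R -> R[i]^o) =O_-oo (fun xi : R => (decay xi)%:C%C : R[i]^o).
Proof.
move=> decay.
have [j [k liou]] := hjk; have [P [P0 P1 mu_ss]] := hmu.
have mF : measurable (F : set (measurableTypeR R)).
  by case: hF => _ cF _; exact: compact_measurable.
have mu01 : mu `[0%R, 1%R]%classic = 1%E.
  have m01 : measurable (`[0, 1]%classic : set (measurableTypeR R)).
    exact: measurable_itv.
  apply/eqP; rewrite eq_le [X in X && _]probability_le1//=.
  by rewrite -[leLHS]hmuF [X in is_true X]le_measure// inE.
have [C C0 [X0 HC]] :=
  energy_decay R A P r b mu j k l alpha hr P0 P1 mu_ss hl liou mu01 halpha.
have bound (xi : R) : expR (Num.max X0 0) <= `|xi| ->
    `|fourier F mu xi| <= (Num.sqrt C)%:C%C * `|(decay xi)%:C%C|.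
  move=> xiX; have xi0 : 0 < `|xi| by apply: lt_le_trans xiX; exact: expR_gt0.
  have lnX : Num.max X0 0 <= ln `|xi|.
    by rewrite -ler_expR lnK.
  have X0ln : X0 <= ln `|xi| by apply: le_trans lnX; rewrite le_max lexx.
  have := HC _ X0ln; rewrite lnK//.
  have -> : energy mu (2 * pi * `|xi|) = energy mu (2 * pi * xi).
    by case: (ger0P xi) => // _; rewrite mulrN energy_opp.
  move=> E; rewrite norm_fourier// normc_def/= expr0n addr0 sqrtr_sqr.
  rewrite -rmorphM lecR ger0_norm ?powR_ge0//.
  apply: le_trans (ler_wsqrtr E) _.
  rewrite sqrtrM// ler_wpM2l ?sqrtr_ge0//.
  (* The square root halves the exponent, whence the factor 2 in its denominator. *)
  rewrite -powR12_sqrt ?powR_ge0// -powRrM le_eqVlt; apply/orP; left; apply/eqP.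
  rewrite /decay; congr (_ `^ _).
  have [/andP[al0 _] _] := halpha.
  by field; rewrite !gt_eqF//; lra.
(* The big-O witness must be positive, while [C] may vanish. *)
have k0 : 0 < (Num.sqrt C + 1)%:C%C :> R[i].
  by rewrite ltcR ltr_wpDl// sqrtr_ge0.
have {}bound (xi : R) : expR (Num.max X0 0) <= `|xi| ->
    `|fourier F mu xi| <= (Num.sqrt C + 1)%:C%C * `|(decay xi)%:C%C|.
  move=> /bound /le_trans; apply; rewrite ler_wpM2r// lecR lerDl//.
split; apply/eqO_exP; exists (Num.sqrt C + 1)%:C%C => //; near=> xi; apply: bound.
- rewrite ger0_norm; near: xi; apply: nbhs_pinfty_ge; exact: num_real.
- rewrite -normrN (le_trans _ (ler_norm _))// lerNr; near: xi.
  by apply: nbhs_ninfty_le; exact: num_real.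
Unshelve. all: by end_near.
Qed.
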